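(* Fix $z_0>0$, $\varepsilon>0$, $x^*\in\mathbb{T}$, $\phi_0^*\in[0,2\pi)$ and $t>0$, and put $z(\varepsilon)=z_0\varepsilon^{-1/2}$. Consider the minimization problem $$\mathcal{P}:\qquad\min\ \sum_{k\in\mathbb{Z}}r_k^2\quad\text{subject to}\quad(r_k,\phi_k)_{k\in\mathbb{Z}}\in\mathcal{D}(t,z(\varepsilon)).$$ Then there exists a unique solution of $\mathcal{P}$ with peak at position $x^*$ at time $t$ and with zeroth phase $\phi_0^*$, and it is given by $(r_k^*,\phi_k^* )_{k\in\mathbb{Z}}$, where $$r_k^*=\frac{c_k\,z(\varepsilon)}{\sum_{j\in\mathbb{Z}}c_j^2},\qquad\phi_k^*=\phi_0^*-kx^*+k^2t\pmod{2\pi}.$$ Moreover, this minimizer satisfies $$\min_{(r_k,\phi_k)_{k\in\mathbb{Z}}\in\mathcal{D}(t,z(\varepsilon))}\ \sum_{k\in\mathbb{Z}}r_k^2=\frac{z(\varepsilon)^2}{\sum_{k\in\mathbb{Z}}c_k^2},$$ and corresponds to the initial datum $$u_0^*(x)=\sum_{k\in\mathbb{Z}}\frac{c_k^2\,z(\varepsilon)}{\sum_{j\in\mathbb{Z}}c_j^2}\,e^{ik(x-x^* )+ik^2t+i\phi_0^*}.$$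
   Context: Coefficients: $c_k=a\,e^{-b|k|}$ for all $k\in\mathbb{Z}$, or $c_k=a\,e^{-b|k|^2}$ for all $k\in\mathbb{Z}$, with $a,b>0$ fixed. $\mathbb{T}=[0,2\pi]$ with periodic boundary conditions. $\mathcal{H}=\{(r_k,\phi_k)_{k\in\mathbb{Z}}:r_k\ge0,\ \phi_k\in[0,2\pi)\}$. For $\vartheta=(r_k,\phi_k)_{k}\in\mathcal{H}$, $u(t,x\mid\vartheta)=\sum_{k\in\mathbb{Z}}c_kr_ke^{ikx+i\phi_k-ik^2t}$ is the solution of the linear Schr\''odinger equation $i\partial_tu+\Delta u=0$ on $\mathbb{T}$ with datum $\sum_kc_kr_ke^{ikx+i\phi_k}$. Also $\mathcal{D}(t,z(\varepsilon))=\{\vartheta\in\mathcal{H}:\sup_{x\in\mathbb{T}}|u(t,x\mid\vartheta)|\ge z_0\varepsilon^{-1/2}\}$. Without affecting the solutions, one may restrict to $(r_k)_k\in\ell^2(\mathbb{Z})$ (otherwise the objective is $+\infty$). ''Peak at position $x^*$ at time $t$'' means $|u(t,x^*\mid\vartheta)|=\sup_{x\in\mathbb{T}}|u(t,x\mid\vartheta)|$; ''zeroth phase $\phi_0^*$'' means $\phi_0=\phi_0^*$. Representatives modulo $2\pi$ are taken in $[0,2\pi)$. *)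

(* Defs.v *)
From HB Require Import structures.
From mathcomp Require Import all_boot all_order all_algebra.
From mathcomp Require Import complex.
From mathcomp Require Import all_classical all_reals all_analysis.
From mathcomp.analysis Require Import showcase.summability.

Set Implicit Arguments.
Unset Strict Implicit.
Unset Printing Implicit Defensive.

Import Order.TTheory GRing.Theory Num.Theory.
Import numFieldNormedType.Exports.

Local Open Scope classical_set_scope.
Local Open Scope complex_scope.
Local Open Scope ring_scope.

(* Unordered sum over Z: the limit of the finite partial sums along the
   directed set {fset int}. It is used with K = R and K = R[i]. *)
Definition zsum {K : numFieldType} (f : int -> K) : K :=
  sum (f : int -> K^o).

(* e^{iy} for real y *)
Definition expi {R : realType} (y : R) : R[i] := cos y +i* sin y.

(* The norm `|z| of z : R[i] lives in R[i]; [normc] is its R-valued version. *)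
Definition modulus {R : realType} (z : R[i]) : R :=
  ComplexField.Normc.normc z.

(* the representative of y modulo 2 pi in [0, 2 pi[ *)
Definition mod2pi {R : realType} (y : R) : R :=
  y - 2 * pi * (Num.floor (y / (2 * pi)))%:~R.

Definition coeff_exponential {R : realType} (a b : R) (k : int) : R :=
  a * expR (- b * `|k|%:~R).

Definition coeff_gaussian {R : realType} (a b : R) (k : int) : R :=
  a * expR (- b * `|k|%:~R ^+ 2).

Definition is_coeff {R : realType} (a b : R) (c : int -> R) : Prop :=
  c = coeff_exponential a b \/ c = coeff_gaussian a b.

(* theta = (r, phi), i.e. the family (r_k, phi_k) indexed by k in Z *)
Definition polar {R : realType} : Type := ((int -> R) * (int -> R))%type.

Definition calH {R : realType} : set (@polar R) :=
  [set theta | forall k : int,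
     0 <= theta.1 k /\ (0 <= theta.2 k /\ theta.2 k < 2 * pi)].

Definition u {R : realType} (c : int -> R) (t x : R) (theta : @polar R)
    : R[i] :=
  zsum (fun k : int => (c k * theta.1 k)%:C *
                       expi (k%:~R * x + theta.2 k - k%:~R ^+ 2 * t)).

Definition sup_modulus {R : realType} (c : int -> R) (t : R)
    (theta : @polar R) : \bar R :=
  ereal_sup [set (modulus (u c t x theta))%:E | x in `[0, 2 * pi]%classic].

(* No square-summability is imposed here. If r is square-summable, the series
   defining u converges absolutely; otherwise the objective below is +oo, so
   the value of u (and membership in calD) is irrelevant to the minimization. *)
Definition calD {R : realType} (c : int -> R) (t z : R) : set (@polar R) :=
  [set theta | calH theta /\ (z%:E <= sup_modulus c t theta)%E].

Definition objective {R : realType} (theta : @polar R) : \bar R :=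
  (\esum_(k in [set: int]) (theta.1 k ^+ 2)%:E)%E.

Definition is_solution {R : realType} (c : int -> R) (t z : R)
    (theta : @polar R) : Prop :=
  calD c t z theta /\
  forall theta', calD c t z theta' -> (objective theta <= objective theta')%E.

Definition peak_at {R : realType} (c : int -> R) (t x : R)
    (theta : @polar R) : Prop :=
  (modulus (u c t x theta))%:E = sup_modulus c t theta.

Definition zeroth_phase {R : realType} (phi0 : R) (theta : @polar R) : Prop :=
  theta.2 0 = phi0.

Definition threshold {R : realType} (z0 eps : R) : R := z0 * eps `^ (- 2^-1).

Definition theta_star {R : realType} (c : int -> R) (z x phi0 t : R)
    : @polar R :=
  (fun k : int => c k * z / zsum (fun j : int => c j ^+ 2),
   fun k : int => mod2pi (phi0 - k%:~R * x + k%:~R ^+ 2 * t)).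

(* Main.v *)
(** For [lam := z / S] and a unimodular [w],
    [0 <= sum_k |r_k e^{i theta_k} - lam c_k w|^2
        = sum_k r_k^2 - 2 lam Re (conj(w) u(t, x)) + lam^2 S],
    where [theta_k = k x + phi_k - k^2 t]. Taking [w := u / |u|] bounds the
    objective below by [2 lam |u(t, x)| - lam^2 S], which is [z^2 / S] when
    [|u(t, x)| = z]. Equality forces [r_k e^{i theta_k} = lam c_k w] for all [k],
    which determines the radii, and the phases up to [w]; the zeroth phase then
    fixes [w = e^{i phi0}]. *)
Require Import Defs.
From mathcomp Require Import all_boot all_order all_algebra.
From mathcomp Require Import finmap complex.
From mathcomp Require Import all_classical all_reals all_analysis.
From mathcomp.analysis Require Import showcase.summability.
From mathcomp Require Import ring lra.

Set Implicit Arguments.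
Unset Strict Implicit.
Unset Printing Implicit Defensive.

Import Order.TTheory GRing.Theory Num.Theory.
Import numFieldNormedType.Exports.

Local Open Scope classical_set_scope.
Local Open Scope complex_scope.
Local Open Scope ring_scope.

(* Unordered sums along the directed set of finite subsets *)
#[local] Existing Instance totally_filter.

(** Convergence is kept as a relation because [zsum] is a [lim], whose value alone does not tell
    whether the family converges; [has_zsum] passes from the relation to the value. *)
Definition has_sum {T : choiceType} {K : numFieldType} (f : T -> K) (l : K) : Prop :=
  partial_sum f @ totally --> (l : K^o).

Section has_sum_numField.
Variables (T : choiceType) (K : numFieldType).
Implicit Types (f g : T -> K) (l m a : K).

Lemma has_sumP f l :
  has_sum f l <-> forall e, 0 < e -> exists A : {fset T}, forall B : {fset T},
    (A `<=` B)%fset -> `|l - \sum_(i <- B) f i| < e.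
Proof.
have eqps B : partial_sum f B = \sum_(i <- B) f i.
  by rewrite /partial_sum big_seq_fsetE.
split.
  move=> /cvgrPdist_lt cf e e0; have [A _ AP] := cf e e0.
  by exists A => B AB; rewrite -eqps; exact: AP.
move=> H; apply/cvgrPdist_lt => e e0; have [A AP] := H e e0.
by exists A => // B AB /=; rewrite eqps; exact: AP.
Qed.

Lemma has_sumD f g l m :
  has_sum f l -> has_sum g m -> has_sum (fun i => f i + g i) (l + m).
Proof.
move=> fl gm; rewrite /has_sum.
rewrite (_ : partial_sum _ = partial_sum f \+ partial_sum g); last first.
  by apply/funext => A; rewrite /partial_sum big_split.
exact: (@cvgD K K^o _ totally _ (partial_sum f) (partial_sum g) l m).
Qed.

Lemma has_sumZ f l a : has_sum f l -> has_sum (fun i => a * f i) (a * l).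
Proof.
move=> fl; rewrite /has_sum.
rewrite (_ : partial_sum _ = a \*: (partial_sum f : {fset T} -> K^o)); last first.
  by apply/funext => A; rewrite /= /partial_sum scaler_sumr.
exact: (@cvgZl_tmp K K^o _ totally _ a (partial_sum f) l).
Qed.

Lemma has_sum_lim f l : has_sum f l -> summability.sum (f : T -> K^o) = l.
Proof. exact: cvg_lim. Qed.

End has_sum_numField.

Lemma has_zsum {K : numFieldType} (f : int -> K) l : has_sum f l -> zsum f = l.
Proof. exact: has_sum_lim. Qed.

(** * Real families: extended sums, comparison, and complex sums *)

Section has_sum_real.
Variables (T : choiceType) (R : realType).
Implicit Types (f g : T -> R) (l : R).

Lemma fsbig_fset_EFin f (B : {fset T}) :
  (\sum_(i \in [set` B]) (f i)%:E)%E = (\sum_(i <- B) f i)%:E.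
Proof. by rewrite fsbig_finite//= set_fsetK sumEFin. Qed.

Lemma ler_sum_fsubset f (A B : {fset T}) : (forall i, 0 <= f i) ->
  (A `<=` B)%fset -> \sum_(i <- A) f i <= \sum_(i <- B) f i.
Proof.
move=> f0 AB; rewrite -lee_fin -!sumEFin.
by apply: lee_sum_nneg_subfset => [i|i _ _]; [exact: (fsubsetP AB)|rewrite lee_fin].
Qed.

Lemma sum_le_has_sum f l (B : {fset T}) :
  (forall i, 0 <= f i) -> has_sum f l -> \sum_(i <- B) f i <= l.
Proof.
move=> f0 /has_sumP fl; apply/ler_addgt0Pr => e e0.
have [A AP] := fl e e0; have := AP _ (fsubsetUl A B).
rewrite ltr_norml => /andP[+ _].
by have := ler_sum_fsubset f0 (fsubsetUr A B); lra.
Qed.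

(** The supremum defining the extended sum is approached within [e] by some finite set; by
    nonnegativity every larger finite set has a partial sum trapped between [l - e] and [l]. *)
Lemma esum_has_sum f l :
  (forall i, 0 <= f i) -> (\esum_(i in [set: T]) (f i)%:E = l%:E)%E -> has_sum f l.
Proof.
move=> f0 fl; apply/has_sumP => e e0.
have : ((l - e)%:E < \esum_(i in [set: T]) (f i)%:E)%E by rewrite fl lte_fin; lra.
move=> /ereal_sup_gt[_ [X [finX _] <-]] leX.
exists (fset_set X) => B XB.
have : ((\sum_(i <- B) f i)%:E <= l%:E)%E.
  rewrite -fl -fsbig_fset_EFin; apply: ereal_sup_ubound; exists [set` B] => //.
move: leX; rewrite -[X]fset_setK// fsbig_fset_EFin !lte_fin lee_fin => leX Bl.
have := ler_sum_fsubset f0 XB.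
by rewrite ger0_norm; lra.
Qed.

Lemma has_sum_esum f l :
  (forall i, 0 <= f i) -> has_sum f l -> (\esum_(i in [set: T]) (f i)%:E = l%:E)%E.
Proof.
move=> f0 fl; apply/eqP; rewrite eq_le; apply/andP; split.
  apply: ge_ereal_sup => _ [X [finX _] <-].
  by rewrite -[X]fset_setK// fsbig_fset_EFin lee_fin sum_le_has_sum.
apply/lee_addgt0Pr => e e0; have /has_sumP/(_ e e0)[A /(_ A (fsubset_refl A))] := fl.
rewrite ltr_norml => /andP[_ lA].
apply: (@le_trans _ _ ((\sum_(i <- A) f i)%:E + e%:E)%E).
  by rewrite -EFinD lee_fin; lra.
rewrite leeD2r// -fsbig_fset_EFin.
by apply: ereal_sup_ubound; exists [set` A].
Qed.

Lemma le_has_sum f l i : (forall j, 0 <= f j) -> has_sum f l -> f i <= l.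
Proof. by move=> f0 /(sum_le_has_sum [fset i]%fset f0); rewrite big_seq_fset1. Qed.

Lemma ge0_dominated_has_sum f g m : (forall i, 0 <= f i <= g i) -> has_sum g m ->
  exists l, has_sum f l.
Proof.
move=> fg gm.
have f0 i : 0 <= f i by have /andP[] := fg i.
have g0 i : 0 <= g i by have /andP[/le_trans/[apply]] := fg i.
have : (\esum_(i in [set: T]) (f i)%:E <= m%:E)%E.
  rewrite -(has_sum_esum g0 gm); apply: le_esum => i _.
  by rewrite lee_fin; have /andP[] := fg i.
have : (0 <= \esum_(i in [set: T]) (f i)%:E)%E by apply: esum_ge0 => i _; rewrite lee_fin.
case E : (\esum_(i in [set: T]) _)%E => [l| |]// _ _.
by exists l; exact: esum_has_sum.
Qed.

(** Reduction to the nonnegative case: [f + g] lies between [0] and [2 * g], and subtracting [g]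
    recovers [f]. *)
Lemma dominated_has_sum f g m : (forall i, `|f i| <= g i) -> has_sum g m ->
  exists l, has_sum f l.
Proof.
move=> fg gm.
have [|l fgl] := @ge0_dominated_has_sum (fun i => f i + g i) _ _ _ (has_sumZ (a := 2) gm).
  by move=> i; have := fg i; rewrite ler_norml; lra.
exists (l + -1 * m); rewrite (_ : f = fun i => (f i + g i) + -1 * g i); last first.
  by apply/funext => i; ring.
by apply: has_sumD => //; exact: has_sumZ.
Qed.

Lemma normc_leD (x y : R) : `|x +i* y| <= (`|x| + `|y|)%:C.
Proof.
have nR (r : R) : `|r%:C| = `|r|%:C by rewrite normc_def/= expr0n addr0 sqrtr_sqr.
rewrite [x +i* y]complexE/= (le_trans (ler_normD _ _))// normrM !nR.
by rewrite normc_def/= expr0n expr1n add0r sqrtr1 mul1r rmorphD.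
Qed.

Lemma has_sum_complex f g l m : has_sum f l -> has_sum g m ->
  has_sum (fun i => f i +i* g i) (l +i* m).
Proof.
move=> /has_sumP fl /has_sumP gm; apply/has_sumP => -[e e'].
(* In the partial order of [R[i]], a positive element has zero imaginary part, so the tolerance is a
   positive real. *)
rewrite ltcE/= => /andP[/eqP -> e0].
have e20 : 0 < e / 2 by lra.
have [A AP] := fl _ e20; have [B BP] := gm _ e20.
exists (A `|` B)%fset => C; rewrite fsubUset => /andP[/AP lC /BP mC].
have -> : \sum_(i <- C) (f i +i* g i) = (\sum_(i <- C) f i) +i* (\sum_(i <- C) g i).
  by apply: (big_ind3 (fun z x y => z = x +i* y)) => // _ x y _ x' y' -> ->.
apply: (@le_lt_trans _ _ (`|l - \sum_(i <- C) f i| + `|m - \sum_(i <- C) g i|)%:C).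
  exact: normc_leD.
by rewrite ltcR; lra.
Qed.

End has_sum_real.

(** * Angles modulo 2 pi *)

Lemma periodicz {U V : zmodType} (f : U -> V) (T : U) :
  periodic f T -> forall (k : int) (x : U), f (x + T *~ k) = f x.
Proof.
move=> fT [n|n] x; first exact: (periodicn fT n x).
by rewrite NegzE mulrNz -[in RHS](subrK (T *~ n.+1) x) [RHS](periodicn fT).
Qed.

Section trigonometry.
Variable R : realType.
Implicit Types x y : R.

Lemma addr_mod2pi x y :
  x + mod2pi y = (x + y) + (pi *+ 2) *~ (- Num.floor (y / (2 * pi))).
Proof. by rewrite /mod2pi addrA mulrNz -[pi *+ 2]mulr_natl mulrzr. Qed.

Lemma expiDmod2pi x y : expi (x + mod2pi y) = expi (x + y).
Proof.
by rewrite /expi addr_mod2pi (periodicz (@cosD2pi R)) (periodicz (@sinD2pi R)).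
Qed.

Lemma mod2pi_itv y : 0 <= mod2pi y < 2 * pi.
Proof.
have pi0 := pi_gt0 R.
have /andP[] := floor_itv (y / (2 * pi)).
rewrite ler_pdivlMr ?ltr_pdivrMr /mod2pi; [|lra..].
by rewrite intrD; lra.
Qed.

(** If [y < x], then [(x - y) / 2] lies strictly between 0 and pi, where the sine is positive; but
    [cos (x - y) = 1] makes the sine of this half-angle vanish. *)
Lemma expi_inj x y : 0 <= x < 2 * pi -> 0 <= y < 2 * pi ->
  expi x = expi y -> x = y.
Proof.
wlog yx : x y / y <= x.
  by move=> H xI yI; case: (leP y x) => [/H|/ltW/H h /esym/h ->//]; exact.
move=> /andP[x0 x2] /andP[y0 y2] [cxy sxy].
have cos1 : cos (x - y) = 1 by rewrite cosB cxy sxy -!expr2 cos2Dsin2.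
have sin0 : sin ((x - y) / 2) = 0.
  apply/eqP; rewrite -sqrf_eq0 sin2cos2.
  have := cos_mulr2n ((x - y) / 2).
  rewrite (_ : (x - y) / 2 *+ 2 = x - y); last by rewrite -mulr_natr; field.
  by rewrite cos1 => h; apply/eqP; move: h; rewrite -mulr_natr; lra.
apply/eqP; rewrite eq_le yx andbT leNgt; apply/negP => xy.
by have := @sin_gt0_pi _ ((x - y) / 2); rewrite sin0 ltxx => /(_ ltac:(lra)).
Qed.

End trigonometry.

(** * Square-summability of the coefficients *)

Section coefficients.
Variable R : realType.

Lemma has_sum_geometric_int (q : R) : 0 < q < 1 ->
  exists l, has_sum (fun k : int => q ^+ `|k|%N) l.
Proof.
move=> /andP[q0 q1]; pose g (n : nat) := (q ^+ n)%:E.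
have gn : (\esum_(n in [set: nat]) g n <= (1 - q)^-1%:E)%E.
  apply: ge_ereal_sup => _ [X [finX _] <-].
  rewrite -[X]fset_setK// fsbig_fset_EFin lee_fin.
  (* [N] exceeds every element of [F], so the first [N] terms of the geometric series include all
     those indexed by [F]. *)
  set F := fset_set X; pose N := (\max_(k <- F) k).+1.
  apply: (@le_trans _ _ (series (geometric 1 q) N)); last first.
    by rewrite (le_trans (geometric_le_lim _ _ _ _)) ?mul1r// gtr0_norm.
  rewrite -lee_fin /series/= -!sumEFin.
  under [leRHS]eq_bigr do rewrite mul1r.
  apply: (@lee_sum_fset_nat _ g F N xpredT) => [i _|k kF].
    by rewrite lee_fin exprn_ge0// ltW.
  by rewrite /= /N ltnS leq_bigmax_seq.
pose h (k : int) := (q ^+ `|k|%N)%:E.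
have h0 k : (0 <= h k)%E by rewrite lee_fin exprn_ge0// ltW.
have : (\esum_(k in [set: int]) h k <= ((1 - q)^-1 + (1 - q)^-1)%:E)%E.
  (* The integers split into the images of [Posz] and [Negz]. Since [Negz n] has absolute value
     [n + 1], its term is at most [q ^+ n], and each half is bounded by the geometric series. *)
  rewrite (esumID (range Posz))//= !setTI.
  rewrite (_ : ~` range Posz = range Negz); last first.
    apply/seteqP; split => [[n []|n _]|_ [n _ <-] []//]; first by exists n.
    by exists n.
  rewrite !esum_image; [|by move=> ? ? _ _ []..].
  rewrite EFinD leeD//; apply: le_trans gn; apply: le_esum => n _ //.
  by rewrite lee_fin ler_wiXn2l// ltW.
have : (0 <= \esum_(k in [set: int]) h k)%E by exact: esum_ge0.
case E : (\esum_(k in [set: int]) _)%E => [l| |]// _ _.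
by exists l; apply: esum_has_sum => // k; rewrite exprn_ge0// ltW.
Qed.

(** One bound serves both families: an integer satisfies [|k| <= |k|^2], so the Gaussian coefficient
    is at most the exponential one. *)
Lemma is_coeff_bound (a b : R) (c : int -> R) (k : int) :
  0 < a -> 0 < b -> is_coeff a b c -> 0 < c k <= a * expR (- b) ^+ `|k|%N.
Proof.
move=> a0 b0 cE; rewrite -expRM_natl.
have -> : `|k|%N%:R * - b = - b * `|k|%:~R by rewrite mulrC -abszE.
case: cE => ->; rewrite /coeff_exponential /coeff_gaussian mulr_gt0 ?expR_gt0//=.
rewrite ler_pM2l// ler_expR ler_nM2l ?oppr_lt0// -rmorphXn/= ler_int.
by case: k => n; rewrite ?absz_nat; rewrite -abszE; case: absz => // m; rewrite ler_eXnr.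
Qed.

Lemma coeff_sqr_has_sum (a b : R) (c : int -> R) :
  0 < a -> 0 < b -> is_coeff a b c -> exists l, has_sum (fun k => c k ^+ 2) l.
Proof.
move=> a0 b0 cE.
have [|l ql] := @has_sum_geometric_int (expR (- b)).
  by rewrite expR_gt0 expR_lt1 oppr_lt0.
apply: (ge0_dominated_has_sum _ (has_sumZ (a := a ^+ 2) ql)) => k.
have /andP[ck0 ck] := is_coeff_bound k a0 b0 cE.
rewrite sqr_ge0/=.
(* Since [expR (- b) ^+ |k| <= 1], squaring it only decreases it, and the geometric family with the
   same ratio still dominates. *)
apply: (@le_trans _ _ ((a * expR (- b) ^+ `|k|%N) ^+ 2)).
  by rewrite ler_sqr// nnegrE ltW// (lt_le_trans ck0).
rewrite exprMn ler_pM2l ?exprn_gt0// expr2 ler_piMr// ?exprn_ge0 ?expR_ge0//.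
by rewrite exprn_ile1 ?expR_ge0// ltW// expR_lt1 oppr_lt0.
Qed.

End coefficients.

(** * The concentration inequality and its defect *)

(** With [w = p +i* q], the second equation says that [Re (conj(w) (a +i* b))] is the modulus. At
    the origin any unit vector works, and [(1, 0)] is taken. *)
Lemma modulus_polar (R : realType) (a b : R) :
  exists p q, p ^+ 2 + q ^+ 2 = 1 /\ p * a + q * b = modulus (a +i* b).
Proof.
rewrite /modulus/=; set m := Num.sqrt _.
have mE : m ^+ 2 = a ^+ 2 + b ^+ 2 by rewrite sqr_sqrtr// addr_ge0 ?sqr_ge0.
have [m0|m0] := eqVneq m 0.
  exists 1, 0; rewrite expr1n expr0n addr0 mul1r mul0r addr0 m0; split => //.
  apply/eqP; rewrite -sqrf_eq0 eq_le sqr_ge0 andbT.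
  by have := sqr_ge0 b; rewrite m0 in mE; lra.
exists (a / m), (b / m); split.
  by rewrite !expr_div_n -mulrDl -mE divff// sqrf_eq0.
by rewrite mulrAC (mulrAC b) -!expr2 -mulrDl -mE expr2 mulfK.
Qed.

Section concentration.
Variables (R : realType) (c : int -> R) (S : R).
Hypothesis cS : has_sum (fun k => c k ^+ 2) S.
Implicit Types (theta : @polar R) (t x : R).

Definition phase t x theta (k : int) : R := k%:~R * x + theta.2 k - k%:~R ^+ 2 * t.

Lemma u_termE t x theta k :
  (c k * theta.1 k)%:C * expi (k%:~R * x + theta.2 k - k%:~R ^+ 2 * t) =
  (c k * theta.1 k * cos (phase t x theta k)) +i*
  (c k * theta.1 k * sin (phase t x theta k)).
Proof. by apply/eqP; rewrite eq_complex/= !mul0r subr0 addr0 !eqxx. Qed.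

(** Each term is dominated by [|c_k r_k| <= c_k^2 + r_k^2], so square-summable radii make the series
    for [u] converge, and its [zsum] is a genuine sum. *)
Lemma u_has_sum t x theta M : has_sum (fun k => theta.1 k ^+ 2) M ->
  exists U V, [/\ has_sum (fun k => c k * theta.1 k * cos (phase t x theta k)) U,
    has_sum (fun k => c k * theta.1 k * sin (phase t x theta k)) V &
    u c t x theta = U +i* V].
Proof.
move=> rM; have crM := has_sumD cS rM.
have dom (f : R -> R) k : (forall y, `|f y| <= 1) ->
    `|c k * theta.1 k * f (phase t x theta k)| <= c k ^+ 2 + theta.1 k ^+ 2.
  move=> f1; rewrite normrM (le_trans (ler_piMr _ (f1 _)))// ler_norml.
  have := sqr_ge0 (c k + theta.1 k); have := sqr_ge0 (c k - theta.1 k).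
  by rewrite sqrrB sqrrD; have := sqr_ge0 (c k); have := sqr_ge0 (theta.1 k); lra.
have [U cU] := dominated_has_sum (fun k => dom cos k (@cos_max R)) crM.
have [V sV] := dominated_has_sum (fun k => dom sin k (@sin_max R)) crM.
exists U, V; split => //.
rewrite /u; under [fun k : int => _]eq_fun do rewrite u_termE.
exact/has_zsum/has_sum_complex.
Qed.

(** The right-hand side is the sum over all modes of the nonnegative left-hand sides, hence bounds
    each of them. Keeping one mode instead of discarding all of them is what later yields
    uniqueness. *)
Lemma alignment_defect_le t x theta M lam :
  has_sum (fun k => theta.1 k ^+ 2) M ->
  exists p q, p ^+ 2 + q ^+ 2 = 1 /\ forall k,
    (theta.1 k * cos (phase t x theta k) - lam * c k * p) ^+ 2 +
    (theta.1 k * sin (phase t x theta k) - lam * c k * q) ^+ 2 <=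
    M - 2 * lam * modulus (u c t x theta) + lam ^+ 2 * S.
Proof.
move=> rM; have [U [V [cU sV ->]]] := u_has_sum t x rM.
have [p [q [pq <-]]] := modulus_polar U V.
exists p, q; split => // k.
apply: (@le_has_sum _ _ (fun k => (theta.1 k * cos (phase t x theta k) - lam * c k * p) ^+ 2 +
    (theta.1 k * sin (phase t x theta k) - lam * c k * q) ^+ 2)).
  by move=> j; rewrite addr_ge0 ?sqr_ge0.
(* The squares expand into four convergent sums: the radii, the two cross terms with the real and
   imaginary parts of [u], and the coefficients. *)
have := has_sumD (has_sumD (has_sumD rM (has_sumZ (a := - 2 * lam * p) cU))
  (has_sumZ (a := - 2 * lam * q) sV)) (has_sumZ (a := lam ^+ 2) cS).
congr has_sum; last by ring.
apply/funext => j.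
have := cos2Dsin2 (phase t x theta j) => cs.
transitivity (theta.1 j ^+ 2 * (cos (phase t x theta j) ^+ 2 + sin (phase t x theta j) ^+ 2)
  + - 2 * lam * p * (c j * theta.1 j * cos (phase t x theta j))
  + - 2 * lam * q * (c j * theta.1 j * sin (phase t x theta j))
  + lam ^+ 2 * c j ^+ 2 * (p ^+ 2 + q ^+ 2)).
  by rewrite cs pq !mulr1.
by ring.
Qed.

Lemma modulus_u_le t x theta M lam :
  has_sum (fun k => theta.1 k ^+ 2) M ->
  2 * lam * modulus (u c t x theta) <= M + lam ^+ 2 * S.
Proof.
(* Any index would do here: only the nonnegativity of the defect is kept. *)
move=> /(alignment_defect_le t x lam)[p [q [_ /(_ 0)]]].
set A := (X in X ^+ 2 + _); set B := (X in _ + X ^+ 2).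
by have := sqr_ge0 A; have := sqr_ge0 B; lra.
Qed.

(** The bound on [|u(t, x)|] is uniform in [x], so it passes to the supremum whether or not a peak
    is attained. *)
Lemma sup_modulus_le t theta M lam : 0 < lam ->
  has_sum (fun k => theta.1 k ^+ 2) M ->
  (sup_modulus c t theta <= ((M + lam ^+ 2 * S) / (2 * lam))%:E)%E.
Proof.
move=> lam0 rM; apply: ge_ereal_sup => _ [x _ <-].
by rewrite lee_fin ler_pdivlMr ?mulr_gt0// mulrC modulus_u_le.
Qed.

End concentration.

(** * Optimality and uniqueness of [theta_star] *)

Section minimizer.
Variables (R : realType) (c : int -> R) (S z t xstar phi0 : R).
Hypothesis c_gt0 : forall k, 0 < c k.
Hypothesis cS : has_sum (fun k => c k ^+ 2) S.
Hypothesis z_gt0 : 0 < z.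
Hypothesis xstar_itv : 0 <= xstar <= 2 * pi.
Hypothesis phi0_itv : 0 <= phi0 < 2 * pi.
Implicit Type theta : @polar R.

Let thetas := theta_star c z xstar phi0 t.

Let S_gt0 : 0 < S.
Proof.
apply: (@lt_le_trans _ _ (c 0 ^+ 2)); first by rewrite exprn_gt0.
by apply: (le_has_sum _ _ cS) => k; exact: sqr_ge0.
Qed.

Let zS_gt0 : 0 < z / S. Proof. exact: divr_gt0. Qed.

Let theta_star1 k : thetas.1 k = z / S * c k.
Proof. by rewrite /= (has_zsum cS); ring. Qed.

Let has_sum_theta_star : has_sum (fun k => thetas.1 k ^+ 2) (z ^+ 2 / S).
Proof.
have := has_sumZ (a := (z / S) ^+ 2) cS.
congr has_sum; first by apply/funext => k; rewrite theta_star1 [RHS]exprMn.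
by field; rewrite gt_eqF.
Qed.

Let objective_finE theta M :
  has_sum (fun k => theta.1 k ^+ 2) M -> objective theta = M%:E.
Proof. by apply: has_sum_esum => k; exact: sqr_ge0. Qed.

Let objective_fin theta M :
  objective theta = M%:E -> has_sum (fun k => theta.1 k ^+ 2) M.
Proof. by apply: esum_has_sum => k; exact: sqr_ge0. Qed.

Lemma objective_theta_star : objective thetas = (z ^+ 2 / S)%:E.
Proof. exact: objective_finE. Qed.

(** The phases are chosen to cancel both the translation [k xstar] and the dispersion [k^2 t], so
    that all modes are aligned at [xstar] at time [t]. *)
Lemma phase_theta_star k : expi (phase t xstar thetas k) = expi phi0.
Proof.
rewrite /phase/= addrAC expiDmod2pi; congr expi; ring.
Qed.

Lemma modulus_theta_star : modulus (u c t xstar thetas) = z.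
Proof.
rewrite /u (_ : (fun k : int => _) =
  fun k => (z / S * cos phi0 * c k ^+ 2) +i* (z / S * sin phi0 * c k ^+ 2)).
  rewrite (has_zsum (has_sum_complex (has_sumZ cS) (has_sumZ cS))).
  rewrite /modulus/= (_ : _ + _ = z ^+ 2 * (cos phi0 ^+ 2 + sin phi0 ^+ 2)).
    by rewrite cos2Dsin2 mulr1 sqrtr_sqr gtr0_norm.
  by field; rewrite gt_eqF.
apply/funext => k; rewrite u_termE theta_star1.
have [-> ->] := phase_theta_star k.
by congr (_ +i* _); ring.
Qed.

(** For [M = z^2 / S] and [lam = z / S] the uniform bound equals [z] exactly, and this value is
    reached at [xstar]. *)
Lemma sup_modulus_theta_star : sup_modulus c t thetas = z%:E.
Proof.
apply/eqP; rewrite eq_le; apply/andP; split.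
  apply: le_trans (sup_modulus_le cS t zS_gt0 has_sum_theta_star) _.
  rewrite lee_fin le_eqVlt; apply/orP; left; apply/eqP; field.
  by rewrite !gt_eqF.
by rewrite -{1}modulus_theta_star; apply: ereal_sup_ubound; exists xstar => //=; rewrite in_itv.
Qed.

Lemma calD_theta_star : calD c t z thetas.
Proof.
split; last by rewrite sup_modulus_theta_star.
move=> k; split; first by rewrite theta_star1 mulr_ge0// ltW.
by have /andP[] := mod2pi_itv (phi0 - k%:~R * xstar + k%:~R ^+ 2 * t).
Qed.

Lemma objective_ge theta : calD c t z theta -> ((z ^+ 2 / S)%:E <= objective theta)%E.
Proof.
move=> [_ zsup]; case E : (objective theta) => [M| |]; last 2 first.
- by rewrite leey.
- have : (0 <= objective theta)%E by apply: esum_ge0 => k _; rewrite lee_fin sqr_ge0.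
  by rewrite E.
(* The choice [lam = z / S] maximizes the lower bound [2 lam z - lam^2 S], with maximum
   [z^2 / S]. *)
have := le_trans zsup (sup_modulus_le cS t zS_gt0 (objective_fin E)).
rewrite !lee_fin ler_pdivlMr ?(mulr_gt0, invr_gt0)//.
have -> : z * (2 * (z / S)) = 2 * (z ^+ 2 / S) by ring.
have -> : (z / S) ^+ 2 * S = z ^+ 2 / S by field; rewrite gt_eqF.
by lra.
Qed.

Lemma is_solution_theta_star : is_solution c t z thetas.
Proof.
split; first exact: calD_theta_star.
by move=> theta /objective_ge; rewrite objective_theta_star.
Qed.

(** Reduction modulo 2 pi fixes [phi0], because both angles lie in the same fundamental interval and
    have the same exponential. *)
Lemma zeroth_phase_theta_star : zeroth_phase phi0 thetas.
Proof.
apply: expi_inj => //; first exact: mod2pi_itv.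
rewrite -[X in expi X]add0r expiDmod2pi add0r; congr expi; ring.
Qed.

Lemma solution_uniq theta : is_solution c t z theta -> peak_at c t xstar theta ->
  zeroth_phase phi0 theta -> theta = thetas.
Proof.
move=> [[thH zsup] min] peak phase0.
have obj : objective theta = (z ^+ 2 / S)%:E.
  apply/eqP; rewrite eq_le objective_ge// andbT -objective_theta_star.
  exact/min/calD_theta_star.
(* The peak condition turns the constraint on the supremum into [z <= |u(t, xstar)|]. *)
move: zsup; rewrite -peak lee_fin => zu.
have [p [q [pq defect]]] := alignment_defect_le cS t xstar (z / S) (objective_fin obj).
have aligned k : theta.1 k * cos (phase t xstar theta k) = z / S * c k * p /\
    theta.1 k * sin (phase t xstar theta k) = z / S * c k * q.
  have := defect k.
  set A := (X in X ^+ 2 + _); set B := (X in _ + X ^+ 2) => AB.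
  (* For [M = z^2 / S] and [lam = z / S] the defect bound is [2 (z / S) (z - |u(t, xstar)|)], which
     is nonpositive. *)
  have AB0 : A ^+ 2 + B ^+ 2 <= 0.
    apply: le_trans AB _.
    have -> : (z / S) ^+ 2 * S = z / S * z by field; rewrite gt_eqF.
    have -> : z ^+ 2 / S = z / S * z by ring.
    have := ler_pM2l zS_gt0 z (modulus (u c t xstar theta)); rewrite zu; lra.
  have /eqP : A ^+ 2 = 0 by have := sqr_ge0 A; have := sqr_ge0 B; lra.
  have /eqP : B ^+ 2 = 0 by have := sqr_ge0 A; have := sqr_ge0 B; lra.
  by rewrite !sqrf_eq0 !subr_eq0 => /eqP ? /eqP ?.
have radius k : theta.1 k = z / S * c k.
  have [ak bk] := aligned k.
  have zc0 : 0 <= z / S * c k by rewrite mulr_ge0// ltW.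
  (* Adding the squares of the two aligned equations eliminates the angles; nonnegativity of the
     radius selects the root. *)
  apply/eqP; rewrite -(@eqrXn2 _ 2)//; last by have [] := thH k.
  apply/eqP; rewrite -[LHS]mulr1 -(cos2Dsin2 (phase t xstar theta k)).
  by rewrite mulrDr -!exprMn ak bk !exprMn -mulrDr pq mulr1.
have angle k : expi (phase t xstar theta k) = p +i* q.
  have [] := aligned k; rewrite radius.
  have zc0 : z / S * c k != 0 by rewrite mulf_neq0// gt_eqF.
  by rewrite /expi => /(mulfI zc0)-> /(mulfI zc0)->.
rewrite [theta]surjective_pairing [thetas]surjective_pairing; congr pair.
  by apply/funext => k; rewrite radius theta_star1.
apply/funext => k; apply: expi_inj.
- by apply/andP; have [_ []] := thH k.
- exact: mod2pi_itv.
(* All modes share the direction [p +i* q]. At [k = 0] the terms in [xstar] and [t] vanish, which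
   identifies it as [expi phi0]. *)
- have /eqP := angle k; rewrite -(angle 0) /phase phase0 eq_complex/=.
  rewrite expr0n !mul0r subr0 add0r => /andP[/eqP ck /eqP sk].
  rewrite -[X in _ = expi X]add0r expiDmod2pi add0r /expi.
  move: ck sk; set A := k%:~R * xstar + _ - _.
  (* Both angles to compare have the form of a total phase minus [s]; as [A] and [phi0] have equal
     cosine and sine, the subtraction formulas conclude. *)
  set s := k%:~R * xstar - k%:~R ^+ 2 * t.
  have -> : phi0 - k%:~R * xstar + k%:~R ^+ 2 * t = phi0 - s by rewrite /s; ring.
  have -> : theta.2 k = A - s by rewrite /A /s; ring.
  by move: A => A cA sA; rewrite !cosB !sinB cA sA.
Qed.

End minimizer.

Theorem proposition5p1 (R : realType) (a b : R) (ha : 0 < a) (hb : 0 < b)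
  (c : int -> R) (hc : is_coeff a b c)
  (z0 eps xstar phi0 t : R) (hz0 : 0 < z0) (heps : 0 < eps)
  (hxstar : 0 <= xstar <= 2 * pi) (hphi0 : 0 <= phi0 < 2 * pi) (ht : 0 < t) :
  let z := threshold z0 eps in
  let S := zsum (fun k : int => c k ^+ 2) in
  let thetas := theta_star c z xstar phi0 t in
  [/\ [/\ is_solution c t z thetas, peak_at c t xstar thetas
        & zeroth_phase phi0 thetas],
      (forall theta : @polar R,
         is_solution c t z theta -> peak_at c t xstar theta ->
         zeroth_phase phi0 theta -> theta = thetas),
      objective thetas = ereal_inf [set objective theta | theta in calD c t z] /\
      objective thetas = (z ^+ 2 / S)%:E
    & forall x : R,
        u c 0 x thetas =
        zsum (fun k : int =>
          (c k ^+ 2 * z / S)%:C *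
          expi (k%:~R * (x - xstar) + k%:~R ^+ 2 * t + phi0))].
Proof.
move=> z S thetas.
have z_gt0 : 0 < z by rewrite mulr_gt0 ?powR_gt0.
have c_gt0 k : 0 < c k by have /andP[] := is_coeff_bound k ha hb hc.
have [S' cS] := coeff_sqr_has_sum ha hb hc.
(* Convergence identifies the abstract limit with the [zsum] named [S] in the statement. *)
have {S' cS} cS : has_sum (fun k => c k ^+ 2) S by rewrite /S (has_zsum cS).
have sol := is_solution_theta_star t phi0 c_gt0 cS z_gt0 hxstar.
split.
- split => //; last exact: zeroth_phase_theta_star.
  rewrite /peak_at (modulus_theta_star _ _ _ c_gt0 cS z_gt0).
  by rewrite (sup_modulus_theta_star _ _ c_gt0 cS z_gt0 hxstar).
- by move=> theta; exact: (solution_uniq c_gt0 cS z_gt0 hxstar).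
- split; last exact: (objective_theta_star _ _ _ _ c_gt0 cS).
  apply/eqP; rewrite eq_le; apply/andP; split.
    by apply: le_ereal_inf_tmp => _ [theta thD <-]; exact: sol.2.
  by apply: ereal_inf_lbound; exists thetas => //; exact: sol.1.
- move=> x; rewrite /u; congr zsum; apply/funext => k.
  (* At time 0 the dispersive term is gone, and the reduction modulo 2 pi is invisible to [expi]. *)
  rewrite mulr0 subr0 expiDmod2pi; congr (_%:C * expi _); last by ring.
  by rewrite /S/=; ring.
Qed.
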